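(* Let $n$ and $k$ be integers with $2\leq k\leq n$. For any graph $G$ of order $n$, $\lambda_k(G)\leq \lambda(G)$. Moreover, the upper bound is tight: for every $k\geq 2$ there is a graph $G$ with $\lambda_k(G)=\lambda(G)$.
   Context: All graphs are undirected, finite and simple. $\lambda(G)$ is the edge-connectivity of $G$. For a graph $G$ and a set $S\subseteq V(G)$ of at least two vertices, a tree connecting $S$ is a subgraph $T$ of $G$ that is a tree with $S\subseteq V(T)$. Let $\lambda(S)$ be the maximum number of pairwise edge-disjoint trees connecting $S$ in $G$. The generalized $k$-edge-connectivity of $G$ is $\lambda_k(G)=\min\{\lambda(S) : S\subseteq V(G),\ |S|=k\}$, with $\lambda_k(G)=0$ when $G$ is disconnected. *)

(* Defs.v *)
From mathcomp Require Import all_boot.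
Set Implicit Arguments.
Unset Strict Implicit.
Unset Printing Implicit Defensive.

Structure sgraph := SGraph {
  vertex :> finType;
  adj : rel vertex;
  adj_sym : symmetric adj;
  adj_irrefl : irreflexive adj }.

Section Graphs.
Variable G : sgraph.

Definition edges : {set {set G}} :=
  [set [set x; y] | x in G, y in adj x].

(* A subgraph candidate is a pair (V, E) of a set of vertices and a set of
   edges, each edge being an unordered pair of vertices. *)
Definition pregraph : finType := ({set G} * {set {set G}})%type.
Implicit Types (H : pregraph) (S : {set G}) (F : {set {set G}}).

Definition subgraph H :=
  (H.2 \subset edges) && [forall A in H.2, A \subset H.1].

Definition step H : rel G := [rel x y | [set x; y] \in H.2].

Definition connected H :=
  (H.1 != set0) && [forall x in H.1, forall y in H.1, connect (step H) x y].

(* A cycle is a duplicate-free cyclic sequence of at least three vertices; its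
   length is at most #|G|, so that bounding the length loses nothing. *)
Definition acyclic H :=
  [forall m : 'I_#|G|.+1, forall c : m.-tuple G,
     (2 < m) ==> ~~ ucycleb (step H) c].

Definition tree_connecting S H :=
  [&& subgraph H, connected H, acyclic H & S \subset H.1].

Definition edge_disjoint (P : {set pregraph}) :=
  [forall H1 in P, forall H2 in P, (H1 != H2) ==> [disjoint H1.2 & H2.2]].

Definition disjoint_trees S (P : {set pregraph}) :=
  [forall H in P, tree_connecting S H] && edge_disjoint P.

(* This is lambda(S). It is meant for 2 <= #|S|: every tree connecting S then
   has an edge, so that edge-disjoint trees are automatically distinct and
   counting sets of trees is the same as counting families of trees. *)
Definition max_disjoint_trees S : nat :=
  \max_(P : {set pregraph} | disjoint_trees S P) #|P|.

Definition graph_connected := connected ([set: G], edges).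

(* lambda_k(G). The default value #|edges| of the minimum is immaterial when
   2 <= k <= #|G|: there is then a set S of k vertices, and lambda(S) is at most
   #|edges| (see max_disjoint_trees_le). *)
Definition gen_edge_connectivity (k : nat) : nat :=
  if graph_connected then
    \big[minn/#|edges|]_(S : {set G} | #|S| == k) max_disjoint_trees S
  else 0.

Definition edge_cut F :=
  (F \subset edges) && ~~ connected ([set: G], edges :\: F).

(* lambda(G). The default value #|edges| is immaterial when 2 <= #|G|, as
   removing all the edges then disconnects G (see edge_cut_edges); on a single
   vertex it yields the usual convention lambda = 0. *)
Definition edge_connectivity : nat :=
  \big[minn/#|edges|]_(F : {set {set G}} | edge_cut F) #|F|.

Lemma tree_has_edge S H :
  1 < #|S| -> tree_connecting S H -> exists A, A \in H.2.
Proof.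
case/card_gt1P=> x [y [xS yS xy]] /and4P[_ /andP[_ con] _ sub].
move/forall_inP/(_ x (subsetP sub x xS)): con => /forall_inP.
move/(_ y (subsetP sub y yS)) => /connectP[[|z p] /= pth yE].
  by rewrite yE eqxx in xy.
by case/andP: pth => xz _; exists [set x; z].
Qed.

Lemma max_disjoint_trees_le S : 1 < #|S| -> max_disjoint_trees S <= #|edges|.
Proof.
move=> S1; apply/bigmax_leqP => P /andP[/forall_inP tP /forall_inP dP].
pose f (H : pregraph) := odflt set0 [pick A in H.2].
have fP H : H \in P -> f H \in H.2.
  move=> HP; rewrite /f; case: pickP => //= no.
  by have [A AH] := tree_has_edge S1 (tP _ HP); move: (no A); rewrite /= AH.
have f_inj : {in P &, injective f}.
  move=> H1 H2 P1 P2 eqf; apply/eqP/negPn/negP => ne.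
  have /forall_inP/(_ _ P2)/implyP/(_ ne) := dP _ P1.
  by move/disjointFr/(_ (fP _ P1)); rewrite eqf fP.
rewrite -(card_in_imset f_inj); apply: subset_leq_card.
apply/subsetP=> _ /imsetP[H HP ->].
by have /and4P[/andP[/subsetP sub _] _ _ _] := tP _ HP; apply/sub/fP.
Qed.

Lemma edge_cut_edges : 1 < #|G| -> edge_cut edges.
Proof.
case/card_gt1P=> x [y [_ _ xy]]; rewrite /edge_cut subxx setDv /=.
apply/negP=> /andP[_ /forall_inP/(_ x (in_setT x))/forall_inP].
move/(_ y (in_setT y))/connectP=> [[|z p] /= pth yE].
  by rewrite yE eqxx in xy.
by move: pth; rewrite /step /= in_set0.
Qed.

End Graphs.

(* Main.v *)
Require Import Defs.
From mathcomp Require Import all_boot order.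
Set Implicit Arguments.
Unset Strict Implicit.
Unset Printing Implicit Defensive.

(** If removing F separates x from y, every tree connecting a set S that
    contains x and y has an edge in F; edge-disjoint trees have distinct such
    edges, so there are at most #|F| of them. Choosing F minimum and S of size k
    gives the bound. A star spanning k vertices is a tree, so both of its
    connectivities are 1. *)

Lemma bigminn_le_cond (I : finType) (P : pred I) (F : I -> nat) m j :
  P j -> \big[minn/m]_(i | P i) F i <= F j.
Proof. by rewrite -minEnat -leEnat; apply: Order.TotalTheory.bigmin_le_cond. Qed.

Lemma leq_bigminn (I : finType) (P : pred I) (F : I -> nat) m b :
  b <= m -> (forall i, P i -> b <= F i) -> b <= \big[minn/m]_(i | P i) F i.
Proof.
move=> bm bF; elim/big_ind: _ => // x y bx by_; by rewrite leq_min bx.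
Qed.

(** Pads [A] with the first [k - #|A|] elements of its complement. *)
Lemma superset_card (T : finType) (A : {set T}) k :
  #|A| <= k -> k <= #|T| -> exists2 B : {set T}, A \subset B & #|B| = k.
Proof.
move=> Ak kT; exists (A :|: [set:: take (k - #|A|) (enum (~: A))]).
  exact: subsetUl.
have disjA : A :&: [set:: take (k - #|A|) (enum (~: A))] = set0.
  apply/setP=> x; rewrite !inE; apply/negbTE/negP=> /andP[xA /mem_take].
  by rewrite mem_enum inE xA.
rewrite cardsU disjA cards0 subn0 cardsE.
have /card_uniqP -> : uniq (take (k - #|A|) (enum (~: A))).
  exact/take_uniq/enum_uniq.
by rewrite size_takel ?subnKC // -cardE [#|~: A|]cardsCs setCK leq_sub2r.
Qed.

Section EdgeCuts.
Variable G : sgraph.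
Implicit Types (S : {set G}) (F : {set {set G}}) (H : pregraph G).

(** An unordered pair may be listed in either order, which symmetry absorbs; the degenerate
    matchings would give a loop. *)
Lemma set2_edges (x y : G) : ([set x; y] \in edges G) = adj x y.
Proof.
apply/imset2P/idP=> [[u v _ uv eq_xy]|xy]; last by exists x y.
have {}uv : adj u v := uv.
have /set2P[] : x \in [set u; v] by rewrite -eq_xy set21.
  move=> xu; have : v \in [set x; y] by rewrite eq_xy set22.
  case/set2P=> vE; last by rewrite xu -vE.
  by move: uv; rewrite vE xu adj_irrefl.
move=> xv; have : u \in [set x; y] by rewrite eq_xy set21.
case/set2P=> uE; last by rewrite xv -uE adj_sym.
by move: uv; rewrite uE xv adj_irrefl.
Qed.

(** If [H] avoided [F], each of its steps would survive the removal of [F], and connectedness of [H]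
    would join [x] to [y]. *)
Lemma tree_meets_cut F S H x y :
  x \in S -> y \in S -> ~~ connect (step ([set: G], edges G :\: F)) x y ->
  tree_connecting S H -> exists A, A \in H.2 :&: F.
Proof.
move=> xS yS ncxy /and4P[/andP[/subsetP HE _] /andP[_ con] _ /subsetP sub].
apply/set0Pn; apply: contra ncxy => /eqP HF0.
have /forall_inP/(_ y (sub _ yS)) := forall_inP con x (sub _ xS).
apply: connect_sub => u v uv; have {}uv : [set u; v] \in H.2 := uv.
apply: connect1; rewrite /step /= inE HE // andbT.
by have := in_set0 [set u; v]; rewrite -HF0 inE uv /= => ->.
Qed.

Lemma max_disjoint_trees_le_cut F S x y :
  x \in S -> y \in S -> ~~ connect (step ([set: G], edges G :\: F)) x y ->
  max_disjoint_trees S <= #|F|.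
Proof.
move=> xS yS ncxy; apply/bigmax_leqP => P /andP[/forall_inP tP /forall_inP dP].
(* Each tree of [P] is charged to one of its edges in [F]; by [fP] the default [set0] never occurs
   on [P]. *)
pose f H := odflt set0 [pick A in H.2 :&: F].
have fP H : H \in P -> f H \in H.2 :&: F.
  move=> HP; rewrite /f; case: pickP => //= no.
  have [A AHF] := tree_meets_cut xS yS ncxy (tP _ HP).
  by move: (no A); rewrite /= AHF.
have f_inj : {in P &, injective f}.
  move=> H1 H2 P1 P2 eqf; apply/eqP/negPn/negP => ne.
  have /forall_inP/(_ _ P2)/implyP/(_ ne) := dP _ P1.
  have /setIP[f1 _] := fP _ P1; have /setIP[f2 _] := fP _ P2.
  by move/disjointFr/(_ f1); rewrite eqf f2.
rewrite -(card_in_imset f_inj); apply: subset_leq_card.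
by apply/subsetP=> _ /imsetP[H HP ->]; have /setIP[] := fP _ HP.
Qed.

Lemma gen_edge_connectivity_le_cut k F :
  1 < k -> k <= #|G| -> edge_cut F -> gen_edge_connectivity G k <= #|F|.
Proof.
move=> k1 kG /andP[_]; rewrite /gen_edge_connectivity; case: ifP => // conG.
(* Removing edges keeps the nonempty vertex set, so the cut must separate some pair [x], [y]. *)
rewrite /connected; case/andP: conG => -> _ /=.
case/forall_inPn=> x _ /forall_inPn[y _ ncxy].
have [S xyS Sk] : exists2 S : {set G}, [set x; y] \subset S & #|S| = k.
  by apply: superset_card kG; apply: leq_trans _ k1; rewrite cards2 ltnS leq_b1.
apply: (@leq_trans (max_disjoint_trees S)).
  by apply: bigminn_le_cond; apply/eqP.
move: xyS; rewrite subUset !sub1set => /andP[xS yS].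
by apply: max_disjoint_trees_le_cut ncxy.
Qed.

Lemma gen_edge_connectivity_le k :
  1 < k -> k <= #|G| -> gen_edge_connectivity G k <= edge_connectivity G.
Proof.
move=> k1 kG; apply: leq_bigminn => [|F]; last exact: gen_edge_connectivity_le_cut.
(* The default value of the minimum is itself the size of a cut, the one removing all edges. *)
exact/(gen_edge_connectivity_le_cut k1 kG)/edge_cut_edges/(leq_trans k1).
Qed.

(** A graph that is a tree connects every [S] by itself, so the family consisting of it alone gives
    at least 1. *)
Lemma gen_edge_connectivity_tree k :
  1 < #|G| -> tree_connecting [set: G] ([set: G], edges G) ->
  0 < gen_edge_connectivity G k.
Proof.
move=> G1 treeG; case/and4P: (treeG) => subG conG acG _.
rewrite /gen_edge_connectivity [graph_connected _]conG.
apply: leq_bigminn => [|S _].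
  have TG : 1 < #|[set: G]| by rewrite cardsT.
  by have [A AE] := tree_has_edge TG treeG; apply/card_gt0P; exists A.
rewrite -(cards1 (([set: G], edges G) : pregraph G)).
apply: leq_bigmax_cond; apply/andP; split.
  by apply/forall_inP => _ /set1P->; apply/and4P; rewrite subsetT.
apply/forall_inP=> _ /set1P->; apply/forall_inP=> _ /set1P->.
by rewrite eqxx.
Qed.

End EdgeCuts.

Section Star.
Variable n : nat.

Definition star_adj : rel 'I_n.+2 := fun x y => (x == ord0) (+) (y == ord0).

Lemma star_adj_sym : symmetric star_adj.
Proof. by move=> x y; rewrite /star_adj addbC. Qed.

Lemma star_adj_irrefl : irreflexive star_adj.
Proof. by move=> x; rewrite /star_adj addbb. Qed.

Definition star := SGraph star_adj_sym star_adj_irrefl.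

Lemma star_step (x y : star) :
  step ([set: star], edges star) x y = (x == ord0) (+) (y == ord0).
Proof. exact: set2_edges. Qed.

Lemma star_connected : graph_connected star.
Proof.
have adj0 (x : star) : x != ord0 ->
    connect (step ([set: star], edges star)) x ord0 /\
    connect (step ([set: star], edges star)) ord0 x.
  by move=> /negbTE x0; split; apply: connect1; rewrite star_step x0 eqxx.
apply/andP; split; first by apply/set0Pn; exists ord0.
apply/forall_inP=> x _; apply/forall_inP=> y _.
apply: (@connect_trans _ _ ord0).
  by have [->|/adj0[]] := eqVneq x ord0.
by have [->|/adj0[]] := eqVneq y ord0.
Qed.

(* Every edge has the centre as an endpoint, so the centre would occur twice
   among four consecutive vertices of a cycle. *)
Lemma star_acyclic : acyclic ([set: star], edges star).
Proof.
apply/forallP=> m; apply/forallP=> c; apply/implyP; rewrite -{1}(size_tuple c).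
case: (val c) => [|x [|y [|z s]]] // _; apply/negP=> /andP[].
rewrite [cycle _ _]/= [uniq _]/= !star_step => /and3P[xy yz zs].
rewrite !inE !negb_or => /and3P[/and3P[_ xz _] /andP[_ ys] _].
have [y0|y0] := eqVneq y ord0; last first.
  by move: xy yz xz; rewrite (negbTE y0) addbF => /eqP-> /eqP->; rewrite eqxx.
(* With [y] the centre, [z] is a leaf, so its successor is the centre again: [x] in a triangle,
   which is a leaf, or else [w], which repeats [y]. *)
move: yz zs xy; rewrite y0 eqxx addbT => /negbTE z0.
case: s ys => [|w s] ys; rewrite [path _ _ _]/=.
  by rewrite andbT star_step z0 => /= ->.
case/andP; rewrite star_step z0 => /= /eqP w0.
by move: ys; rewrite y0 w0 inE eqxx.
Qed.

Lemma star_tree : tree_connecting [set: star] ([set: star], edges star).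
Proof.
apply/and4P; split=> //; [|exact: star_connected|exact: star_acyclic].
by apply/andP; split=> //; apply/forall_inP=> A _; apply: subsetT.
Qed.

(** The vertex [ord_max] is a leaf, and removing its only edge isolates it. *)
Lemma star_edge_connectivity_le1 : edge_connectivity star <= 1.
Proof.
rewrite -(cards1 ([set ord_max; ord0] : {set star})).
apply: bigminn_le_cond; apply/andP; split.
  by rewrite sub1set set2_edges.
apply/negP=> /andP[_ /forall_inP/(_ ord_max (in_setT _))/forall_inP].
move/(_ ord0 (in_setT _))/connectP=> [[|z p] //= /andP[]].
move=> /setDP[edge_z cut_z] _ _.
have : step ([set: star], edges star) ord_max z := edge_z.
by rewrite star_step => /= /eqP z0; rewrite z0 inE eqxx in cut_z.
Qed.

End Star.

Theorem proposition3 :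
  (forall (n k : nat) (G : sgraph), 2 <= k -> k <= n -> #|G| = n ->
     gen_edge_connectivity G k <= edge_connectivity G) /\
  (forall k : nat, 2 <= k ->
     exists G : sgraph,
       k <= #|G| /\ gen_edge_connectivity G k = edge_connectivity G).
Proof.
split=> [n k G k2 kn Gn | [|[|n]] // _].
  by apply: gen_edge_connectivity_le => //; rewrite Gn.
have Gn : #|star n| = n.+2 by rewrite card_ord.
exists (star n); split; first by rewrite Gn.
apply/eqP; rewrite eqn_leq gen_edge_connectivity_le ?Gn //=.
(* The reverse inequality passes through 1, the star being a tree. *)
apply: leq_trans (star_edge_connectivity_le1 n) _.
by apply: gen_edge_connectivity_tree (star_tree n); rewrite ?Gn.
Qed.
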